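(* Let $(J,\mathcal{B})$ be a standard Borel space, let $\alpha,\beta\in\mathcal{M}(\mathcal{B}^2)$ with $\alpha\le\beta$, let $\varphi\colon\mathcal{B}\to\mathbb{R}$ be a bounded continuous submodular set function with $\varphi(\emptyset)=\varphi(J)=0$, and let $v\colon J\times J\to\mathbb{R}_{\ge0}$ be bounded and measurable. Put $$\mathcal{F}_\varphi(J,\mathcal{B},\alpha,\beta)=\{\mu\in\mathcal{M}(\mathcal{B}^2):\ \alpha\le\mu\le\beta,\ \partial\mu\le\varphi \text{ on }\mathcal{B}\}.$$ Let $c\in\mathbb{R}$. There exists $\mu\in\mathcal{F}_\varphi(J,\mathcal{B},\alpha,\beta)$ with $\mu(v)=c$ if and only if $\mathcal{F}_\varphi(J,\mathcal{B},\alpha,\beta)\neq\emptyset$ and for every potential $F(x,y)=f(x)-f(y)$ with $f\colon J\to\mathbb{R}$ bounded measurable and $f\ge0$, $$\alpha((F+v)^+)-\beta((F+v)^-)-\hat{\varphi}(f)\ \le\ c\ \le\ \beta((F+v)^+)-\alpha((F+v)^-)+\hat{\varphi}(-f).$$ Consequently, $$\inf_{\mu\in\mathcal{F}_\varphi(J,\mathcal{B},\alpha,\beta)}\mu(v)=\sup_{F=f(x)-f(y),\ f\ge0}\left[\alpha((F+v)^+)-\beta((F+v)^-)-\hat{\varphi}(f)\right]$$ and $$\sup_{\mu\in\mathcal{F}_\varphi(J,\mathcal{B},\alpha,\beta)}\mu(v)=\inf_{F=f(x)-f(y),\ f\ge0}\left[\beta((F+v)^+)-\alpha((F+v)^-)+\hat{\varphi}(-f)\right],$$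 where the supremum and infimum on the right-hand sides range over all such potentials $F$ (with $f$ bounded measurable, $f\ge 0$).
   Context: $\mathcal{M}(\mathcal{B}^2)$ is the set of finite signed measures on $(J\times J,\mathcal{B}^2)$, where $\mathcal{B}^2$ is the product Borel $\sigma$-algebra. $\mu\le\nu$ means $\nu-\mu$ is a (nonnegative) measure. $X^c=J\setminus X$. The boundary of $\mu$ is $\partial\mu(X)=\mu(X\times X^c)-\mu(X^c\times X)$, $X\in\mathcal{B}$. For a bounded measurable function $g$ and a signed measure $\mu$, $\mu(g)=\int g\,\mathrm{d}\mu$; $g^+=g\vee0$ and $g^-=(-g)\vee0$, so $g=g^+-g^-$. A set function $\varphi\colon\mathcal{B}\to\mathbb{R}$ is submodular if $\varphi(A)+\varphi(B)\ge\varphi(A\cap B)+\varphi(A\cup B)$ for all $A,B\in\mathcal{B}$, and continuous if $\varphi(A_n)\to\varphi(A)$ whenever $A,A_n\in\mathcal{B}$ and $\mathbf{1}_{A_n}\to\mathbf{1}_A$ pointwise on $J$. A potential is a function $F\colon J\times J\to\mathbb{R}$ of the form $F(x,y)=f(x)-f(y)$ with $f\colon J\to\mathbb{R}$ bounded measurable. For a bounded measurable $f\colon J\to\mathbb{R}$, the Choquet integral is $\hat{\varphi}(f)=\int_0^\infty\varphi(\{x\in J: f(x)+C\ge t\})\,\mathrm{d}t-C\varphi(J)$, where $C\in\mathbb{R}$ is any constant with $f+C\ge0$ (the value does not depend on $C$). *)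

(* Defs.v *)
From HB Require Import structures.
From mathcomp Require Import all_boot all_order all_algebra.
From mathcomp Require Import all_classical all_reals all_analysis.
Set Implicit Arguments.
Unset Strict Implicit.
Unset Printing Implicit Defensive.
Import Order.TTheory GRing.Theory Num.Theory.
Import numFieldNormedType.Exports.
Local Open Scope classical_set_scope.
Local Open Scope ring_scope.

(* The measurable space J is isomorphic to a complete separable metric space T
   equipped with its Borel sigma-algebra. Completeness is spelled out because
   the library's complete spaces are pointed, and J may be empty here. *)
Definition standard_borel (R : realType) (d : measure_display)
    (J : measurableType d) : Prop :=
  exists T : metricType R,
    [/\ exists2 D : set T, countable D & dense D,
        forall F : set_system T, ProperFilter F -> cauchy F ->
          exists x : T, F --> x
      & exists2 f : J -> T, bijective f &
          (measurable : set (set J)) =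
          preimage_set_system [set: J] f <<s [set U : set T | open U]>>].

Section signed_measures.
Context (R : realType) (d : measure_display) (T : measurableType d).

Definition charge_le (mu nu : {charge set T -> \bar R}) : Prop :=
  forall A, measurable A -> (0 <= nu A - mu A)%E.

(* The value does not depend on the chosen Hahn decomposition. *)
Definition charge_integral (mu : {charge set T -> \bar R}) (g : T -> R) : R :=
  let muPN := svalP (cid (svalP (cid (Hahn_decomposition mu)))) in
  \int[jordan_pos muPN]_x g x - \int[jordan_neg muPN]_x g x.

End signed_measures.

(* Set functions on the sigma-algebra of J are total functions [set J -> R];
   their values on non-measurable sets are never constrained nor used. *)
Section set_functions.
Context (R : realType) (d : measure_display) (J : measurableType d).
Implicit Types (phi : set J -> R) (f : J -> R).

Definition submodular phi : Prop :=
  forall A B, measurable A -> measurable B ->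
    phi (A `&` B) + phi (A `|` B) <= phi A + phi B.

Definition setfun_continuous phi : Prop :=
  forall (A_ : nat -> set J) (A : set J),
    (forall n, measurable (A_ n)) -> measurable A ->
    (forall x, (\1_(A_ n) x : R) @[n --> \oo] --> (\1_A x : R)) ->
    phi (A_ n) @[n --> \oo] --> phi A.

(* C is an arbitrary constant with f + C >= 0. *)
Definition choquet phi f : R :=
  let C := xget 0 [set C : R | forall x, 0 <= f x + C] in
  \int[lebesgue_measure]_(t in `[0, +oo[) phi [set x | t <= f x + C]
  - C * phi setT.

Definition potential f : (J * J)%type -> R := fun xy => f xy.1 - f xy.2.

Definition boundary (mu : {charge set (J * J)%type -> \bar R}) (X : set J) : \bar R :=
  (mu (X `*` ~` X) - mu (~` X `*` X))%E.

Definition feasible (alpha beta : {charge set (J * J)%type -> \bar R}) phi :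
    set ({charge set (J * J)%type -> \bar R}) :=
  [set mu | [/\ charge_le alpha mu, charge_le mu beta &
    forall X, measurable X -> (boundary mu X <= (phi X)%:E)%E]].

End set_functions.

(* Main.v *)
Require Import Defs.
From HB Require Import structures.
From mathcomp Require Import all_boot all_order all_algebra.
From mathcomp Require Import all_classical all_reals all_analysis.
From mathcomp Require Import measurable_realfun lra ring.
Set Implicit Arguments.
Unset Strict Implicit.
Unset Printing Implicit Defensive.
Import Order.TTheory GRing.Theory Num.Theory.
Import numFieldNormedType.Exports.
Local Open Scope classical_set_scope.
Local Open Scope ring_scope.

(** A flow nu with alpha <= nu <= beta, boundary at most phi and nu v = c solves
    a system of linear inequalities: nu (potential 1_X) <= phi X for every
    measurable X, nu v <= c and nu (- v) <= - c. By the Hahn-Banach theorem, in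
    the form of Mazur and Orlicz (mazur_orlicz), a linear functional solving it
    below a given sublinear functional exists as soon as no nonnegative
    combination of the inequalities contradicts the latter. The sublinear
    functional is box_sup g = beta (g^+) - alpha (g^-), the largest value of
    nu g over alpha <= nu <= beta. A linear functional below it lies between
    alpha and beta on indicators, so it is countably additive as they are, and
    it is integration against a charge (charge_of_functional,
    charge_between_cone).

    A combination of the inequalities reads nu (F + b v) <= r + b c, where F is
    the potential of f = sum_i a_i 1_(X_i) and r = sum_i a_i phi (X_i) with
    a_i >= 0. It contradicts box_sup when the least possible value box_inf of
    nu (F + b v) exceeds r + b c. As phi is submodular, the Choquet integral of
    f is at most r (choquet_indic_cone). For b > 0, scaled to b = 1, the lower
    bound on c at f therefore excludes a contradiction; for b < 0, scaled to
    b = -1, the upper bound at M - f does, for a constant M making this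
    function nonnegative; for b = 0 the existence of a feasible flow does
    (strong_duality).

    Conversely, let nu be feasible. The layer cake formula writes nu F as the
    integral over t of the boundary of nu at {f >= t}, hence nu F is at most the
    Choquet integral of f (flow_potential_le), and the two bounds on nu v follow
    from nu v = nu (F + v) - nu F (weak_duality).

    When feasible flows exist, the supremum of the lower bounds and the infimum
    of the upper bounds satisfy the criterion themselves, so they are attained as
    values nu v. When there are none, a contradictory combination exists with
    v = 0 and c = 0, and the dual bounds are unbounded along its multiples
    (infeasible_unbounded). *)

(** * Sublinear functionals and the Mazur-Orlicz theorem *)

Section sublinear.
Context (R : realType) (V : lmodType R).
Implicit Types (p q : V -> R) (K : set (V * R)).

Definition sublinear p :=
  (forall x y, p (x + y) <= p x + p y) /\
  (forall t x, 0 <= t -> p (t *: x) = t * p x).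

Definition convex_cone K :=
  [/\ K (0, 0), forall z w, K z -> K w -> K (z.1 + w.1, z.2 + w.2) &
      forall t z, 0 <= t -> K z -> K (t *: z.1, t * z.2)].

(** Subhomogeneity for positive factors is enough: applied to the inverse
    factor it gives the reverse inequality. *)
Lemma sublinear_from_le p : (forall x y, p (x + y) <= p x + p y) ->
  (forall t x, 0 < t -> p (t *: x) <= t * p x) -> p 0 = 0 -> sublinear p.
Proof.
move=> pD pZ p0; split=> // t x; rewrite le_eqVlt => /orP[/eqP<-|t0].
  by rewrite scale0r p0 mul0r.
apply/eqP; rewrite eq_le pZ//= -ler_pdivlMl//.
have := pZ t^-1 (t *: x).
by rewrite scalerA mulVf ?gt_eqF// scale1r invr_gt0; apply.
Qed.

Lemma sublinear0 p : sublinear p -> p 0 = 0.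
Proof. by move=> [_ /(_ 0 0 (lexx _))]; rewrite scale0r mul0r. Qed.

Lemma sublinear_geN p x : sublinear p -> - p (- x) <= p x.
Proof.
move=> sp; have := sp.1 x (- x); rewrite subrr (sublinear0 sp); lra.
Qed.

(** The infimal convolution of q with the cone K, where a pair (u, r) of K
    stands for the wish that a linear functional be at most r at u: a linear
    functional below q fulfils all these wishes iff it is below this one. *)
Definition infconv q K x := inf [set q (x - z.1) + z.2 | z in K].

Section infconv_theory.
Variables (q : V -> R) (K : set (V * R)).
Hypotheses (sq : sublinear q) (cK : convex_cone K).
Hypothesis qK : forall z, K z -> 0 <= q (- z.1) + z.2.

Lemma infconv_ge x : lbound [set q (x - z.1) + z.2 | z in K] (- q (- x)).
Proof.
move=> _ [z Kz <-]; have := qK Kz; have := sq.1 (- x) (x - z.1).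
by rewrite addrA addNr sub0r; lra.
Qed.

Lemma infconv_le x z : K z -> infconv q K x <= q (x - z.1) + z.2.
Proof.
by move=> Kz; apply: ge_inf; [exists (- q (- x)); exact: infconv_ge|exists z].
Qed.

Lemma infconv_glb x r : (forall z, K z -> r <= q (x - z.1) + z.2) ->
  r <= infconv q K x.
Proof.
move=> h; apply: lb_le_inf; last by move=> _ [z Kz <-]; exact: h.
by case: cK => K0 _ _; exists (q (x - 0) + 0), (0, 0).
Qed.

Lemma infconv_sublinear : sublinear (infconv q K).
Proof.
case: (cK) => K0 KD KZ; apply: sublinear_from_le.
- move=> x y; rewrite -lerBlDr; apply: infconv_glb => z Kz.
  rewrite lerBlDr -lerBlDl; apply: infconv_glb => w Kw.
  rewrite lerBlDl; apply: le_trans (infconv_le (x + y) (KD _ _ Kz Kw)) _ => /=.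
  rewrite opprD addrACA.
  have := sq.1 (x - z.1) (y - w.1); lra.
- move=> t x t0; rewrite -ler_pdivrMl//; apply: infconv_glb => z Kz.
  rewrite ler_pdivrMl// mulrDr -(sq.2 _ _ (ltW t0)) scalerBr.
  by have := infconv_le (t *: x) (KZ _ _ (ltW t0) Kz).
- apply/eqP; rewrite eq_le; apply/andP; split.
    by apply: le_trans (infconv_le 0 K0) _; rewrite /= subrr (sublinear0 sq) addr0.
  by apply: infconv_glb => z Kz; rewrite sub0r qK.
Qed.

Lemma infconv_le_self x : infconv q K x <= q x.
Proof. by case: (cK) => K0 _ _; have := infconv_le x K0; rewrite /= subr0 addr0. Qed.

Lemma infconv_le_cone z : K z -> infconv q K z.1 <= z.2.
Proof.
by move=> Kz; have := infconv_le z.1 Kz; rewrite subrr (sublinear0 sq) add0r.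
Qed.

End infconv_theory.

(** Relaxing a sublinear m by the single wish L (- y) <= - m y gives a smaller
    sublinear functional; if m is minimal, nothing was gained, so
    m (- y) = - m y. An odd sublinear functional is additive. *)
Lemma minimal_sublinear_linear m : sublinear m ->
  (forall p, sublinear p -> (forall x, p x <= m x) -> p = m) -> linear_for *%R m.
Proof.
move=> sm minm.
have mN y : m (- y) = - m y.
  apply/eqP; rewrite eq_le; apply/andP; split; last first.
    by have := sublinear_geN y sm; lra.
  (* the ray spanned by the wish L (- y) <= - m y *)
  pose K := [set z : V * R | exists2 t, 0 <= t & z = (- (t *: y), - (t * m y))].
  have cK : convex_cone K.
    split.
    - by exists 0; rewrite ?lexx// scale0r mul0r !oppr0.
    - move=> _ _ [s s0 ->] [t t0 ->]; exists (s + t); first exact: addr_ge0.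
      by rewrite /= scalerDl mulrDl !opprD.
    - move=> s _ s0 [t t0 ->]; exists (s * t); first exact: mulr_ge0.
      by rewrite /= scalerN mulrN scalerA mulrA.
  have mK z : K z -> 0 <= m (- z.1) + z.2.
    by move=> [t t0 ->] /=; rewrite opprK sm.2// subrr.
  rewrite -[in leLHS](minm _ (infconv_sublinear sm cK mK)); last first.
    exact: infconv_le_self.
  have Ky : K (- y, - m y) by exists 1; rewrite ?ler01// scale1r mul1r.
  exact: (infconv_le_cone sm mK Ky).
have mD x y : m (x + y) = m x + m y.
  apply/eqP; rewrite eq_le sm.1/= -[leRHS]opprK -mN opprD.
  by have := sm.1 (- x) (- y); rewrite !mN; lra.
have mZ t x : m (t *: x) = t * m x.
  have [t0|t0] := leP 0 t; first exact: sm.2.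
  by rewrite -[t]opprK scaleNr mN sm.2 ?mulNr// oppr_ge0 ltW.
by move=> t x y; rewrite mD mZ.
Qed.

(** Zorn's lemma provides a minimal sublinear functional below p. The pointwise
    infimum of a chain is finite because m x >= - p (- x) for every m below p,
    and it is subadditive because two members of the chain are comparable. *)
Lemma sublinear_ge_linear p : sublinear p ->
  exists2 L : V -> R, linear_for *%R L & forall x, L x <= p x.
Proof.
move=> sp.
pose S := {m : V -> R | sublinear m /\ forall x, m x <= p x}.
pose r (m n : S) : bool := `[< forall x, sval n x <= sval m x >].
have pS (m : S) x : - p (- x) <= sval m x.
  case: m => m [sm mp] /=; apply: le_trans (sublinear_geN x sm).
  by rewrite lerN2.
have [||||m mmin] := @Zorn S r.
- by move=> m; apply/asboolP.
- move=> a b c /asboolP ab /asboolP bc; apply/asboolP => x.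
  exact: le_trans (bc x) (ab x).
- move=> [a pa] [b pb] /asboolP/= ab /asboolP/= ba; apply: eq_exist.
  by apply/funext => x; apply/eqP; rewrite eq_le ab ba.
- move=> A totA.
  have [[a0 Aa0]|/forallNP A0] := pselect (A !=set0); last first.
    by exists (exist _ p (conj sp (fun=> lexx _))) => s /A0.
  pose E x := [set sval a x | a in A].
  have lbE x : lbound (E x) (- p (- x)) by move=> _ [a _ <-]; exact: pS.
  pose m x := inf (E x).
  have mle a x : A a -> m x <= sval a x.
    by move=> Aa; apply: ge_inf; [exists (- p (- x))|exists a].
  have mglb x c : (forall a, A a -> c <= sval a x) -> c <= m x.
    move=> h; apply: lb_le_inf; first by exists (sval a0 x), a0.
    by move=> _ [a Aa <-]; exact: h.
  have sm : sublinear m.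
    apply: sublinear_from_le.
    - move=> x y; rewrite -lerBlDr; apply: (mglb) => a Aa.
      rewrite lerBlDr -lerBlDl; apply: (mglb) => b Ab; rewrite lerBlDl.
      have [/asboolP ab|/asboolP ba] := totA a b Aa Ab.
      + apply: le_trans (mle _ _ Ab) _; apply: le_trans ((svalP b).1.1 x y) _.
        by rewrite lerD2r.
      + apply: le_trans (mle _ _ Aa) _; apply: le_trans ((svalP a).1.1 x y) _.
        by rewrite lerD2l.
    - move=> t x t0; rewrite -ler_pdivrMl//; apply: (mglb) => a Aa.
      by rewrite ler_pdivrMl// -((svalP a).1.2 _ _ (ltW t0)); exact: mle.
    - apply/eqP; rewrite eq_le; apply/andP; split.
        by apply: le_trans (mle _ _ Aa0) _; rewrite sublinear0//; case: (svalP a0).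
      by apply: (mglb) => a _; rewrite sublinear0//; case: (svalP a).
  have mp x : m x <= p x.
    by apply: le_trans (mle _ _ Aa0) _; case: (svalP a0).
  by exists (exist _ m (conj sm mp)) => s As; apply/asboolP => x /=; exact: mle.
- exists (sval m); last by case: (svalP m).
  apply: minimal_sublinear_linear; first by case: (svalP m).
  move=> n sn nm.
  have np x : n x <= p x by apply: le_trans (nm x) _; case: (svalP m).
  have := mmin (exist _ n (conj sn np)) => <- //.
  by apply/asboolP => x /=; exact: nm.
Qed.

(** The Mazur-Orlicz form of the Hahn-Banach theorem: a cone of linear
    inequalities L u <= r can be met by a linear functional below q as soon as
    no single one of them contradicts q. *)
Theorem mazur_orlicz q K : sublinear q -> convex_cone K ->
  (forall z, K z -> 0 <= q (- z.1) + z.2) ->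
  exists L : V -> R, [/\ linear_for *%R L, forall x, L x <= q x &
    forall z, K z -> L z.1 <= z.2].
Proof.
move=> sq cK qK.
have [L Llin Lle] := sublinear_ge_linear (infconv_sublinear sq cK qK).
exists L; split=> // [x|z Kz]; apply: le_trans (Lle _) _.
- exact: infconv_le_self.
- exact: infconv_le_cone.
Qed.

End sublinear.

(** * Bounded functionals on bounded measurable functions *)

Section bounded_measurable.
Context (R : realType) (d : measure_display) (T : measurableType d).
Implicit Types (g h : T -> R) (F G : (T -> R) -> R).

Definition bmeas g := bounded_fun g /\ measurable_fun setT g.

Lemma bounded_fun_le (U : Type) (g : U -> R) :
  bounded_fun g <-> exists M : R, forall x, `|g x| <= M.
Proof.
split=> [[M [_ +]]|[M gM]].
  by move/(_ (M + 1)) => h; exists (M + 1) => x; apply: h => //; rewrite ltrDl.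
exists M; split; first exact: num_real.
by move=> N MN x _; apply: le_trans (gM x) _; exact: ltW.
Qed.

Lemma bmeasP g : bmeas g -> exists M : R, forall x, `|g x| <= M.
Proof. by move=> [/bounded_fun_le]. Qed.

Lemma bmeas_cst (r : R) : bmeas (cst r).
Proof. by split=> //; apply/bounded_fun_le; exists `|r|. Qed.

Lemma bmeas_indic (A : set T) : measurable A -> bmeas (\1_A).
Proof.
move=> mA; split; last exact: measurable_indic.
by apply/bounded_fun_le; exists 1 => x; rewrite indicE; case: (_ \in _);
  rewrite ?normr1 ?normr0.
Qed.

Lemma bmeas_lin (a : R) g h : bmeas g -> bmeas h ->
  bmeas (fun x => a * g x + h x).
Proof.
move=> [/bounded_fun_le[M gM] mg] [/bounded_fun_le[N hN] mh]; split.
  apply/bounded_fun_le; exists (`|a| * M + N) => x.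
  apply: le_trans (ler_normD _ _) _; rewrite lerD// normrM.
  by rewrite ler_wpM2l.
apply: measurable_funD => //; apply: measurable_funM => //.
Qed.

Lemma bmeasD g h : bmeas g -> bmeas h -> bmeas (g \+ h).
Proof.
move=> bg bh; have := bmeas_lin 1 bg bh.
by under eq_fun do rewrite mul1r.
Qed.

Lemma bmeasZ (a : R) g : bmeas g -> bmeas (fun x => a * g x).
Proof.
move=> bg; have := bmeas_lin a bg (bmeas_cst 0).
by under eq_fun do rewrite /= addr0.
Qed.

Lemma bmeasN g : bmeas g -> bmeas (\- g).
Proof.
move=> bg; have := bmeasZ (-1) bg.
by under eq_fun do rewrite mulN1r.
Qed.

Lemma bmeas_pos g : bmeas g -> bmeas g^\+.
Proof.
move=> [/bounded_fun_le[M gM] mg]; split; last exact: measurable_funrpos.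
apply/bounded_fun_le; exists M => x; rewrite /funrpos; move: (gM x).
by rewrite !ler_norml le_max ge_max; lra.
Qed.

Lemma bmeas_neg g : bmeas g -> bmeas g^\-.
Proof. by move=> /bmeasN/bmeas_pos; rewrite funrposN. Qed.

(** Linear functionals on bounded measurable functions that are bounded for the
    supremum norm; F is unconstrained on all other functions. *)
Definition bounded_linear F :=
  (forall a g h, bmeas g -> bmeas h ->
     F (fun x => a * g x + h x) = a * F g + F h) /\
  exists K, forall g e, bmeas g -> (forall x, `|g x| <= e) -> `|F g| <= K * e.

Section bounded_linear_theory.
Variable F : (T -> R) -> R.
Hypothesis linF : bounded_linear F.

Lemma blinD g h : bmeas g -> bmeas h -> F (g \+ h) = F g + F h.
Proof.
move=> bg bh; have := linF.1 1 g h bg bh; rewrite mul1r => <-.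
by congr F; apply/funext => x /=; rewrite mul1r.
Qed.

Lemma blin0 : F (cst 0) = 0.
Proof.
have := blinD (bmeas_cst 0) (bmeas_cst 0).
have -> : cst 0 \+ cst 0 = cst 0 :> (T -> R) by apply/funext => x /=; rewrite addr0.
lra.
Qed.

Lemma blinZ a g : bmeas g -> F (fun x => a * g x) = a * F g.
Proof.
move=> bg; have := linF.1 a g _ bg (bmeas_cst 0); rewrite blin0 addr0 => <-.
by congr F; apply/funext => x /=; rewrite addr0.
Qed.

Lemma blinN g : bmeas g -> F (\- g) = - F g.
Proof.
move=> bg; rewrite -mulN1r -blinZ//; congr F.
by apply/funext => x /=; rewrite mulN1r.
Qed.

Lemma blinB g h : bmeas g -> bmeas h -> F (g \- h) = F g - F h.
Proof.
move=> bg bh; rewrite -blinN// -blinD//; last exact: bmeasN.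
Qed.

(** A bounded functional is positive as soon as it is so on indicators. Peel off
    layers of height e: if g <= (n+1) e, then g - e 1_(g >= e) is nonnegative
    and at most n e, so by induction F g >= F r for some r with values in
    [0, e], and F r >= - K e. Then let e tend to 0. *)
Lemma blin_ge0 : (forall A, measurable A -> 0 <= F (\1_A)) ->
  forall g, bmeas g -> (forall x, 0 <= g x) -> 0 <= F g.
Proof.
move=> FA g bg g0; have [_ [K FK]] := linF.
have step (e : R) : 0 < e -> forall n h, bmeas h ->
    (forall x, 0 <= h x <= n.+1%:R * e) -> - (K * e) <= F h.
  move=> e0; elim=> [|n IH] h bh h0.
    have : `|F h| <= K * e.
      apply: FK => // x; have /andP[hx0 hx1] := h0 x.
      by rewrite ger0_norm//; rewrite mul1r in hx1.
    by rewrite ler_norml => /andP[].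
  pose A := [set x | e <= h x].
  have mA : measurable A.
    have -> : A = setT `&` h @^-1` `[e, +oo[.
      by rewrite setTI; apply/seteqP; split=> x /=; rewrite in_itv/= andbT.
    by apply: bh.2 => //; exact: measurable_itv.
  pose h' x := - e * \1_A x + h x.
  have bh' : bmeas h' by apply: bmeas_lin => //; exact: bmeas_indic.
  have Fh' : F h' = - e * F (\1_A) + F h.
    by rewrite linF.1//; exact: bmeas_indic.
  have : - (K * e) <= F h'.
    apply: IH => // x; rewrite /h' indicE.
    have /andP[hx0 hx1] := h0 x.
    have n0 : 0 <= n%:R * e by rewrite mulr_ge0// ltW.
    move: hx1; rewrite -!(natr1 n) -natr1 !mulrDl !mul1r => hx1.
    have [xA|xA] := boolP (x \in A).
      by move: xA; rewrite inE /A /= mulr1 => ?; lra.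
    by move: xA; rewrite notin_setE /A /= => /negP; rewrite -ltNge mulr0 => ?; lra.
  have : 0 <= e * F (\1_A) by rewrite mulr_ge0 ?FA// ltW.
  by rewrite Fh'; lra.
have [M gM] := bmeasP bg.
(* n + 1 layers suffice as soon as (n + 1) e bounds g *)
have eps (e : R) : 0 < e -> - (K * e) <= F g.
  move=> e0; apply: (step _ e0 (Num.truncn (M / e))) => // x; rewrite g0/=.
  apply: le_trans (ler_norm _) _; apply: le_trans (gM x) _.
  by rewrite -ler_pdivrMr// ltW// Num.Theory.truncnS_gt.
rewrite leNgt; apply/negP => Fg.
have K1 : 0 < `|K| + 1 by rewrite ltr_wpDl.
have e0 : 0 < - F g / (2 * (`|K| + 1)).
  by rewrite divr_gt0 ?oppr_gt0// mulr_gt0.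
have := eps _ e0; set e := - F g / _ in e0 *.
have Fe : - F g = 2 * (`|K| + 1) * e by rewrite /e mulrC divfK// gt_eqF// mulr_gt0.
have : K * e <= `|K| * e by rewrite ler_wpM2r ?ler_norm// ltW.
have : 0 <= `|K| * e by rewrite mulr_ge0// ltW.
by lra.
Qed.

End bounded_linear_theory.

Lemma bounded_linearB F G : bounded_linear F -> bounded_linear G ->
  bounded_linear (fun g => F g - G g).
Proof.
move=> [l1 [K1 b1]] [l2 [K2 b2]]; split.
  by move=> a g h bg bh; rewrite l1// l2//; ring.
exists (K1 + K2) => g e bg ge; apply: le_trans (ler_normB _ _) _.
by rewrite mulrDl lerD ?b1 ?b2.
Qed.

Lemma bounded_linear_eq F G : bounded_linear F -> bounded_linear G ->
  (forall A, measurable A -> F (\1_A) = G (\1_A)) ->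
  forall g, bmeas g -> F g = G g.
Proof.
move=> lF lG FG.
have eq0 g : bmeas g -> (forall x, 0 <= g x) -> F g = G g.
  move=> bg g0; apply: le_anti; apply/andP; split; rewrite -subr_ge0.
    by apply: (blin_ge0 (bounded_linearB lG lF)) => // A mA; rewrite FG// subrr.
  by apply: (blin_ge0 (bounded_linearB lF lG)) => // A mA; rewrite FG// subrr.
move=> g bg; have gE : g^\+ \- g^\- = g := funrposBneg g.
rewrite -gE.
have bp := bmeas_pos bg; have bn := bmeas_neg bg.
rewrite (blinB lF bp bn) (blinB lG bp bn) (eq0 _ bp (funrpos_ge0 g)).
by rewrite (eq0 _ bn (funrneg_ge0 g)).
Qed.

End bounded_measurable.

Section charge_integral_theory.
Context (R : realType) (d : measure_display) (T : measurableType d).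
Implicit Types (g h : T -> R) (mu nu : {charge set T -> \bar R}).

(** All that is used about integration against a charge: it is a difference of
    integrals against finite measures whose difference is the charge. *)
Lemma charge_integral_difference nu : exists P N : {finite_measure set T -> \bar R},
  (forall A, measurable A -> nu A = (P A - N A)%E) /\
  forall g, charge_integral nu g = \int[P]_x g x - \int[N]_x g x.
Proof.
set muPN := svalP (cid (svalP (cid (Hahn_decomposition nu)))).
exists (jordan_pos muPN), (jordan_neg muPN); split=> // A mA.
by rewrite (jordan_decomp muPN mA) /cadd/= cscaleN1.
Qed.

Lemma bmeas_integrable (P : {finite_measure set T -> \bar R}) g :
  bmeas g -> P.-integrable setT (EFin \o g).
Proof.
move=> [bg mg]; apply: measurable_bounded_integrable => //.
by rewrite ltey_eq fin_num_measure.
Qed.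

Lemma Rintegral_bounded_linear (P : {finite_measure set T -> \bar R}) :
  bounded_linear (fun g => \int[P]_x g x).
Proof.
split=> [a g h bg bh|].
  rewrite RintegralD//; last 2 first.
  - by apply: bmeas_integrable; exact: bmeasZ.
  - exact: bmeas_integrable.
  by rewrite RintegralZl//; exact: bmeas_integrable.
exists (fine (P setT)) => g e bg ge.
apply: le_trans (le_normr_Rintegral _ (bmeas_integrable P bg)) _ => //.
rewrite mulrC -Rintegral_cst//; apply: le_Rintegral => //.
- have /integrable_norm := bmeas_integrable P bg; exact.
- exact: bmeas_integrable (bmeas_cst _ _).
Qed.

Lemma charge_integral_bounded_linear nu : bounded_linear (charge_integral nu).
Proof.
have [P [N [_ E]]] := charge_integral_difference nu.
rewrite (funext E).
exact: bounded_linearB (Rintegral_bounded_linear P) (Rintegral_bounded_linear N).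
Qed.

Lemma charge_integral_indic nu A : measurable A ->
  charge_integral nu (\1_A) = fine (nu A).
Proof.
move=> mA; have [P [N [nuE E]]] := charge_integral_difference nu.
rewrite E nuE// fineB ?fin_num_measure//.
by rewrite /Rintegral !integral_indic// setIT.
Qed.

Lemma le_charge_integral mu nu g : charge_le mu nu -> bmeas g ->
  (forall x, 0 <= g x) -> charge_integral mu g <= charge_integral nu g.
Proof.
move=> munu bg g0; rewrite -subr_ge0.
apply: (blin_ge0 (bounded_linearB (charge_integral_bounded_linear nu)
  (charge_integral_bounded_linear mu))) => // A mA.
have := munu A mA; rewrite !charge_integral_indic//.
have fin (la : {charge set T -> \bar R}) : la A \is a fin_num by apply: fin_num_measure.
by rewrite -[la in (0 <= la - _)%E]fineK// -[X in (_ - X)%E]fineK// -EFinB lee_fin.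
Qed.

End charge_integral_theory.

(** * Functionals between two charges *)

Section charge_of_functional.
Context (R : realType) (d : measure_display) (T : measurableType d).
Implicit Types (F G : (T -> R) -> R) (A B : set T).

Lemma blin_indicU F A B : bounded_linear F -> measurable A -> measurable B ->
  A `&` B = set0 -> F (\1_(A `|` B)) = F (\1_A) + F (\1_B).
Proof.
move=> lF mA mB AB0.
rewrite -(blinD lF (bmeas_indic _ mA) (bmeas_indic _ mB)); congr F.
apply/funext => x /=; rewrite !indicE in_setU.
have [xA|xA] := boolP (x \in A); have [xB|xB] := boolP (x \in B);
  rewrite ?addr0 ?add0r//.
by move: xA xB; rewrite !inE => xA xB; have : (A `&` B) x by []; rewrite AB0.
Qed.

(** The defect of countable additivity along E is the value of F on a tail, a
    set decreasing to the empty set. *)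
Lemma blin_indic_tail F (E : nat -> set T) n : bounded_linear F ->
  (forall i, measurable (E i)) -> trivIset setT E ->
  F (\1_(\bigcup_i E i)) - \sum_(0 <= i < n) F (\1_(E i)) =
  F (\1_(\bigcup_(i in [set k | (n <= k)%N]) E i)).
Proof.
move=> lF mE tE; elim: n => [|n IH].
  rewrite big_geq// subr0; congr (F \1_(_)).
  by apply: eq_bigcupl; split.
rewrite big_nat_recr//= opprD addrA IH.
have -> : \bigcup_(i in [set k | (n <= k)%N]) E i =
    E n `|` \bigcup_(i in [set k | (n < k)%N]) E i.
  apply/seteqP; split=> [x [k /= nk Ekx]|x [Enx|[k /= nk Ekx]]].
  - by move: nk; rewrite leq_eqVlt => /orP[/eqP ->|nk]; [left|right; exists k].
  - by exists n => /=.
  - by exists k => //=; exact: ltnW.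
rewrite blin_indicU//; first by rewrite addrC addKr.
- exact: bigcup_measurable.
- apply/seteqP; split=> // x [Enx [k /= nk Ekx]].
  have : k = n by apply: (tE k n I I); exists x.
  by move=> kn; rewrite kn ltnn in nk.
Qed.

Variables (F : (T -> R) -> R) (alpha beta : {charge set T -> \bar R}).
Hypothesis linF : bounded_linear F.
Hypothesis F_alpha : forall A, measurable A -> fine (alpha A) <= F (\1_A).
Hypothesis F_beta : forall A, measurable A -> F (\1_A) <= fine (beta A).

Let nu A : \bar R := if `[< measurable A >] then (F (\1_A))%:E else 0%E.

Let nuE A : measurable A -> nu A = (F (\1_A))%:E.
Proof. by move=> mA; rewrite /nu asboolT. Qed.

(** For a charge that defect vanishes in the limit. *)
Let charge_tail (la : {charge set T -> \bar R}) (E : nat -> set T) :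
  (forall i, measurable (E i)) -> trivIset setT E ->
  fine (la (\bigcup_(i in [set k | (n <= k)%N]) E i)) @[n --> \oo] --> (0 : R).
Proof.
move=> mE tE; have mU := bigcupT_measurable E mE.
have lla := charge_integral_bounded_linear la.
have tailE n : fine (la (\bigcup_(i in [set k | (n <= k)%N]) E i)) =
    fine (la (\bigcup_i E i)) - \sum_(0 <= i < n) fine (la (E i)).
  rewrite -!charge_integral_indic//; last exact: bigcup_measurable.
  rewrite -(blin_indic_tail _ lla)//; congr (_ - _).
  by apply: eq_bigr => i _; rewrite charge_integral_indic.
rewrite (funext tailE).
have <- : nbhs (fine (la (\bigcup_i E i)) - fine (la (\bigcup_i E i))) = nbhs (0 : R).
  by rewrite subrr.
apply: cvgB; first exact: cvg_cst.
have := @charge_semi_sigma_additive _ _ _ la E mE tE mU.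
rewrite -(fineK (fin_num_measure la _ mU)) => /fine_cvg.
apply: cvg_trans; apply: near_eq_cvg; apply: nearW => n /=.
by rewrite sum_fine// => i _; exact: fin_num_measure.
Qed.

Let nu0 : nu set0 = 0%E.
Proof. by rewrite nuE// indic0 blin0. Qed.

Let nu_fin A : measurable A -> nu A \is a fin_num.
Proof. by move=> mA; rewrite nuE. Qed.

Let nu_sigma_additive : semi_sigma_additive nu.
Proof.
move=> E mE tE mU; rewrite nuE//.
have -> : (fun n => (\sum_(0 <= i < n) nu (E i))%E) =
    fun n => (\sum_(0 <= i < n) F (\1_(E i)))%:E.
  by apply/funext => n; rewrite -sumEFin; apply: eq_bigr => i _; rewrite nuE.
apply/fine_cvgP; split; first exact: nearW.
rewrite -(subr0 (F _)).
have -> : fine \o (fun n => (\sum_(0 <= i < n) F (\1_(E i)))%:E) =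
    fun n => F (\1_(\bigcup_i E i)) -
      F (\1_(\bigcup_(i in [set k | (n <= k)%N]) E i)).
  by apply/funext => n /=; rewrite -blin_indic_tail// opprB addrC subrK.
apply: cvgB; first exact: cvg_cst.
apply: squeeze_cvgr (charge_tail alpha mE tE) (charge_tail beta mE tE).
by apply: nearW => n; rewrite F_alpha ?F_beta//; exact: bigcup_measurable.
Qed.

HB.instance Definition _ := isCharge.Build _ _ _ nu nu0 nu_fin nu_sigma_additive.

(** Countable additivity comes for free: the tails of F are squeezed between
    those of alpha and beta, which tend to 0. *)
Lemma charge_of_functional : exists mu : {charge set T -> \bar R},
  [/\ charge_le alpha mu, charge_le mu beta &
      forall g, bmeas g -> charge_integral mu g = F g].
Proof.
have fin (la : {charge set T -> \bar R}) A : measurable A ->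
  la A \is a fin_num by exact: fin_num_measure.
exists nu; split=> [A mA|A mA|].
- rewrite [X in (X - _)%E](nuE mA) -[alpha A]fineK ?fin// -EFinB lee_fin.
  by rewrite subr_ge0 F_alpha.
- rewrite [X in (_ - X)%E](nuE mA) -[beta A]fineK ?fin// -EFinB lee_fin.
  by rewrite subr_ge0 F_beta.
- apply: bounded_linear_eq => //; first exact: charge_integral_bounded_linear.
  by move=> A mA; rewrite charge_integral_indic//= [X in fine X](nuE mA).
Qed.

End charge_of_functional.

(** * Translations, superlevel sets and measurability in the level *)

Section lebesgue_translation.
Context (R : realType).
Notation mu := (@lebesgue_measure R).

Lemma measurable_addr (a : R) : measurable_fun [set: R] (fun t : R => t + a).
Proof. exact: measurable_funD. Qed.

Lemma lebesgue_measure_translation (a : R) (A : set R) : measurable A ->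
  pushforward mu (fun t : R => t + a : measurableTypeR R) A = mu A.
Proof.
move=> mA; apply/esym/lebesgue_measure_unique => //=.
  exact: measurable_addr.
move=> _ _ [[u v]] _ <-; rewrite /pushforward.
have -> : (fun t : R => t + a) @^-1` [set` `]u, v] ] = [set` `]u - a, v - a] ].
  by apply/seteqP; split=> x /=; rewrite !in_itv/= ltrBlDr lerBrDr.
rewrite /= !lebesgue_measure_itv/= !lte_fin ltrBlDr subrK; case: ifP => // _.
by rewrite -!EFinD opprB addrA subrK.
Qed.

Lemma integrable_translation (h : R -> R) (a : R) :
  mu.-integrable setT (EFin \o h) ->
  mu.-integrable setT (EFin \o (fun t => h (t + a))) /\
  \int[mu]_t h (t + a) = \int[mu]_t h t.
Proof.
move=> hi; have [mh hfin] := integrableP _ _ _ hi.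
have ha : mu.-integrable setT (EFin \o (fun t => h (t + a))).
  apply/integrableP; split.
    exact: (measurableT_comp mh (measurable_addr a)).
  apply: le_lt_trans hfin.
  rewrite -[leLHS](@ge0_integral_pushforward _ _ (measurableTypeR R)
    (measurableTypeR R) R (fun t : R => t + a) (measurable_addr a) mu setT
    (fun t => `|(h t)%:E|%E))//; last exact: measurableT_comp.
  rewrite le_eqVlt; apply/orP; left; apply/eqP.
  apply: eq_measure_integral => [|ma A mA _]; first exact: measurable_addr.
  exact: lebesgue_measure_translation.
split=> //; congr fine.
rewrite -[LHS](@integral_pushforward _ _ (measurableTypeR R)
    (measurableTypeR R) R (fun t : R => t + a) (measurable_addr a) mu setT
    (EFin \o h))//.
apply: eq_measure_integral => [|ma A mA _]; first exact: measurable_addr.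
exact: lebesgue_measure_translation.
Qed.

Lemma bounded_support_integrable (h : R -> R) (a b : R) : bmeas h ->
  (forall t, h t != 0 -> a <= t <= b) -> mu.-integrable setT (EFin \o h).
Proof.
move=> [bh mh] h0.
have hE : EFin \o h = (EFin \o h) \_ `[a, b].
  apply/funext => t; rewrite patchE; case: ifPn => //.
  rewrite notin_setE /= in_itv/= => tab.
  by have [->|/h0/tab] := eqVneq (h t) 0.
rewrite hE; apply/integrable_restrict => //=; rewrite setTI.
apply: measurable_bounded_integrable => //.
- by rewrite /= lebesgue_measure_itv/=; case: ifP => // _; rewrite -EFinB ltry.
- exact: measurable_funTS.
- have [M hM] := bmeasP (conj bh mh).
  exists M; split; first exact: num_real.
  by move=> N MN x _; apply: le_trans (hM x) (ltW MN).
Qed.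

End lebesgue_translation.

Section floor_approximation.
Context (R : realType).
Implicit Types (g : R -> R) (t : R).

(** The largest multiple of 1 / (n + 1) that is at most t. *)
Definition floorn (n : nat) t : R := (Num.floor (n.+1%:R * t))%:~R / n.+1%:R.

Lemma floorn_le n t : floorn n t <= t.
Proof.
by rewrite /floorn ler_pdivrMr// mulrC; exact: Num.Theory.floor_le.
Qed.

Lemma floorn_gt s t : s < t -> \forall n \near \oo, s < floorn n t.
Proof.
move=> st; have ts0 : 0 < t - s by rewrite subr_gt0.
exists (Num.truncn (t - s)^-1) => // n /= nle.
rewrite /floorn ltr_pdivlMr//.
have := Num.Theory.floorD1_gt (n.+1%:R * t); rewrite intrD.
have : (t - s)^-1 < n.+1%:R by rewrite -Num.Theory.truncn_le_nat.
rewrite invf_plt ?posrE// -(ltr_pM2l (x := n.+1%:R))// mulfV//.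
rewrite mulrBr [s * _]mulrC; lra.
Qed.

(** Such a g is a pointwise limit of the functions g o floorn n, each constant on
    countably many intervals. *)
Lemma measurable_floorn_cvg g :
  (forall t, g (floorn n t) @[n --> \oo] --> g t) -> measurable_fun setT g.
Proof.
move=> gcvg.
apply: (@measurable_fun_cvg _ _ _ _ (fun n t => g (floorn n t))); last first.
  by move=> t _; exact: gcvg.
move=> n _ Y mY; rewrite setTI.
have -> : (fun t => g (floorn n t)) @^-1` Y =
    \bigcup_(k in [set k : int | Y (g (k%:~R / n.+1%:R))])
      [set t : R | Num.floor (n.+1%:R * t) = k].
  apply/seteqP; split=> [t /= Yt|t [k /= Yk fk]].
    by exists (Num.floor (n.+1%:R * t)).
  by rewrite /floorn fk.
rewrite bigcup_mkcond; apply: countable_bigcupT_measurable => // k.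
case: ifP => // _.
have -> : [set t : R | Num.floor (n.+1%:R * t) = k] =
    [set` `[k%:~R / n.+1%:R, (k + 1)%:~R / n.+1%:R[ ].
  apply/seteqP; split=> t /=; rewrite in_itv/= ler_pdivrMr// ltr_pdivlMr//;
    rewrite [t * _]mulrC -Num.Theory.floor_eq => /eqP //.
exact: measurable_itv.
Qed.

End floor_approximation.

Section level_sets.
Context (R : realType) (d : measure_display) (J : measurableType d).
Implicit Types (f : J -> R) (X : set J).

Definition level f (t : R) : set J := [set x | t <= f x].

Lemma measurable_level f t : measurable_fun setT f -> measurable (level f t).
Proof.
move=> mf; have -> : level f t = setT `&` f @^-1` `[t, +oo[.
  by rewrite setTI; apply/seteqP; split=> x /=; rewrite in_itv/= andbT.
by apply: mf => //; exact: measurable_itv.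
Qed.

(** Superlevel sets are left-continuous in the level, so approximating the level
    from below is harmless. *)
Lemma indic_level_floorn f X t x :
  (\1_(X `&` level f (floorn n t)) x : R) @[n --> \oo] --> (\1_(X `&` level f t) x : R).
Proof.
apply: cvg_near_cst; have [ft|ft] := leP t (f x).
  apply: nearW => n; rewrite !indicE; congr (_%:R); congr nat_of_bool.
  apply: asbool_equiv_eq.
  split=> -[Xx _]; split=> //.
  by rewrite /level/=; apply: le_trans ft; exact: floorn_le.
near=> n; rewrite !indicE !memNset//.
  by rewrite /level => -[_ /=]; rewrite leNgt ft.
rewrite /level => -[_ /=]; rewrite leNgt; apply/negP/negPn.
by near: n; exact: floorn_gt.
Unshelve. all: by end_near.
Qed.

Variable phi : set J -> R.
Hypotheses (phi_bounded : [bounded phi A | A in measurable])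
  (phi_continuous : setfun_continuous phi).

Lemma setfun_bound : exists M : R, forall A, measurable A -> `|phi A| <= M.
Proof.
have [M [_ phiM]] := phi_bounded.
by exists (M + 1) => A mA; apply: phiM => //; rewrite ltrDl.
Qed.

(** Continuity of phi serves to make these functions of the level measurable. *)
Lemma bmeas_level f X : measurable_fun setT f -> measurable X ->
  bmeas (fun t => phi (X `&` level f t)).
Proof.
move=> mf mX.
have mS t : measurable (X `&` level f t).
  by apply: measurableI => //; exact: measurable_level.
split.
  have [M phiM] := setfun_bound.
  by apply/bounded_fun_le; exists M => t; exact: phiM.
by apply: measurable_floorn_cvg => t; apply: phi_continuous => // x;
  exact: indic_level_floorn.
Qed.

End level_sets.

(** * Choquet integrals of submodular set functions *)

Section choquet_integral.
Context (R : realType) (d : measure_display) (J : measurableType d).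
Variable phi : set J -> R.
Hypotheses (phi_bounded : [bounded phi A | A in measurable])
  (phi_continuous : setfun_continuous phi)
  (phi0 : phi set0 = 0) (phiT : phi setT = 0).
Implicit Types (f : J -> R) (X : set J).
Notation mu := (@lebesgue_measure R).

Lemma bmeas_profile f : measurable_fun setT f -> bmeas (fun t => phi (level f t)).
Proof.
move=> mf; have := bmeas_level phi_bounded phi_continuous mf measurableT.
by under eq_fun do rewrite setTI.
Qed.

Lemma profile_support f (K t : R) : (forall x, `|f x| <= K) ->
  phi (level f t) != 0 -> - K <= t <= K.
Proof.
move=> fK; apply: contraNT => tK; apply/eqP.
have [Kt|tK'] := ltP K t.
  rewrite (_ : level f t = set0)// -subset0 => x; rewrite /level/= => tf.
  by have := fK x; rewrite ler_norml => /andP[]; lra.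
have {tK tK'} tK : t < - K by move: tK; rewrite tK' andbT -ltNge.
rewrite (_ : level f t = setT)// -subTset => x _; rewrite /level/=.
by have := fK x; rewrite ler_norml => /andP[]; lra.
Qed.

Lemma integrable_profile f : bmeas f ->
  mu.-integrable setT (EFin \o (fun t => phi (level f t))).
Proof.
move=> bf; have [K fK] := bmeasP bf.
apply: (@bounded_support_integrable _ _ (- K) K).
  by apply: bmeas_profile; case: bf.
by move=> t; exact: profile_support.
Qed.

(** As phi vanishes on the empty set and on J, the integrand has bounded support
    and the shift by C is a translation: the Choquet integral is an integral
    over the whole line. *)
Lemma choquetE f : bmeas f -> choquet phi f = \int[mu]_t phi (level f t).
Proof.
move=> bf; rewrite /choquet; set C := xget _ _.
have fC x : 0 <= f x + C.
  have [K fK] := bmeasP bf.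
  apply: (@xgetPex _ 0 [set C | forall x, 0 <= f x + C]).
  by exists K => y; have := fK y; rewrite ler_norml => /andP[]; lra.
rewrite phiT mulr0 subr0 -(integrable_translation (- C) (integrable_profile bf)).2.
rewrite Rintegral_mkcond; apply: eq_Rintegral => t _; rewrite patchE.
have E : [set x | t <= f x + C] = level f (t + - C).
  by apply/seteqP; split=> x; rewrite /level/= lerBlDr.
case: ifPn => [_|]; first by rewrite E.
rewrite notin_setE /= in_itv/= andbT => /negP; rewrite -ltNge => t0.
rewrite (_ : level f _ = setT)// -subTset => x _.
by rewrite -E/=; apply: le_trans (ltW t0) (fC x).
Qed.

Lemma choquet_addr f (c : R) : bmeas f ->
  choquet phi (fun x => f x + c) = choquet phi f.
Proof.
move=> bf; have bfc : bmeas (fun x => f x + c) by exact: bmeasD bf (bmeas_cst _ c).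
rewrite !choquetE// -(integrable_translation (- c) (integrable_profile bf)).2.
apply: eq_Rintegral => t _; congr phi.
by apply/seteqP; split=> x; rewrite /level/= lerBlDr.
Qed.

Lemma choquet0 : choquet phi (cst 0) = 0.
Proof.
rewrite choquetE; last exact: bmeas_cst.
under eq_Rintegral => t _.
  rewrite (_ : phi _ = 0); first over.
  have [t0|t0] := leP t 0.
    by rewrite (_ : level _ _ = setT)// -subTset => x _.
  rewrite (_ : level _ _ = set0)// -subset0 => x; rewrite /level/=; lra.
by rewrite Rintegral_cst// mul0r.
Qed.

Hypothesis phi_submodular : submodular phi.

(** Put A_t = {f >= t}. The superlevel set of a 1_X + f at t is the union of A_t
    and of X meet A_(t - a), and these two meet in X meet A_t. Submodularity bounds
    its phi by phi A_t + phi (X meet A_(t - a)) - phi (X meet A_t). The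
    difference of the last two terms integrates to a phi X, because
    phi (X meet A_t) is phi X for t <= 0 and vanishes for large t. *)
Lemma choquet_add_indic f X (a : R) : bmeas f -> (forall x, 0 <= f x) ->
  measurable X -> 0 <= a ->
  choquet phi (fun x => a * \1_X x + f x) <= a * phi X + choquet phi f.
Proof.
move=> bf f0 mX a0; have [K fK] := bmeasP bf.
have mf : measurable_fun setT f by case: bf.
have bg : bmeas (fun x => a * \1_X x + f x).
  by apply: bmeas_lin => //; exact: bmeas_indic.
pose g x := a * \1_X x + f x.
pose h t := phi (X `&` level f t).
have bh : bmeas h by exact: bmeas_level.
(* h takes the value phi X on the whole negative half-line; h0 is h without
   this part, and has bounded support *)
pose h0 t := - phi X * \1_`]-oo, 0%R] t + h t.
have ih0 : mu.-integrable setT (EFin \o h0).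
  apply: (@bounded_support_integrable _ _ 0 `|K|).
    apply: bmeas_lin => //; apply: bmeas_indic; exact: measurable_itv.
  move=> t; apply: contraNT; rewrite negb_and -!ltNge /h0 indicE => /orP[t0|tK].
    rewrite mem_set/= ?in_itv/= ?ltW// mulr1 /h.
    rewrite (_ : level f t = setT) ?setIT ?addNr// -subTset => x _.
    by rewrite /level/=; apply: le_trans (ltW t0) (f0 x).
  have t0 : 0 < t := le_lt_trans (normr_ge0 K) tK.
  rewrite memNset/=; last by rewrite in_itv/= leNgt t0.
  rewrite mulr0 add0r /h (_ : level f t = set0) ?setI0 ?phi0//.
  rewrite -subset0 => x; rewrite /level/=; apply/negP; rewrite -ltNge.
  apply: le_lt_trans (ler_norm _) _; apply: le_lt_trans (fK x) _.
  exact: le_lt_trans (ler_norm K) tK.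
have ih0a := integrable_translation (- a) ih0.
(* the half-lines removed at t and at t - a differ by this interval *)
pose b t := phi X * \1_`]0%R, a] t.
have ib : mu.-integrable setT (EFin \o b).
  apply: (@bounded_support_integrable _ _ 0 a).
    apply: bmeasZ; apply: bmeas_indic; exact: measurable_itv.
  move=> t; apply: contraNT => ta; rewrite /b indicE memNset ?mulr0//=.
  rewrite in_itv/= => /andP[t0 t1]; move: ta; rewrite t1 ltW//.
have Eb : \int[mu]_t b t = a * phi X.
  rewrite /b RintegralZl//; last exact: integrable_indic_itv.
  rewrite mulrC; congr (_ * _).
  rewrite /Rintegral integral_indic//= setIT lebesgue_measure_itv/= lte_fin.
  case: ifPn => [|]; first by rewrite -EFinB subr0.
  by rewrite -leNgt => ?; apply/eqP; rewrite eq_le a0.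
have ip := integrable_profile bf.
have iB : mu.-integrable setT (EFin \o (fun t => h0 (t + - a) - h0 t)).
  exact: (integrableB measurableT ih0a.1 ih0).
rewrite !choquetE//.
have -> : a * phi X + \int[mu]_t phi (level f t) =
    \int[mu]_t (phi (level f t) + (h0 (t + - a) - h0 t) + b t).
  rewrite RintegralD//; last exact: (integrableD measurableT ip iB).
  rewrite RintegralD// RintegralB//; last exact: ih0a.1.
  by rewrite ih0a.2 subrr addr0 Eb addrC.
apply: le_Rintegral => //; first exact: integrable_profile.
  exact: (integrableD measurableT (integrableD measurableT ip iB) ib).
move=> t _.
have sub : level f t `<=` level f (t - a).
  by move=> x; rewrite /level/=; lra.
have levelE : level g t = level f t `|` (X `&` level f (t - a)).
  apply/seteqP; split=> x; rewrite /level/g/= indicE.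
    have [|_ tf] := boolP (x \in X); last by left; move: tf; rewrite mulr0 add0r.
    by rewrite inE => Xx tf; right; split=> //; move: tf; rewrite mulr1; lra.
  move=> [tf|[Xx tf]]; last by rewrite mem_set// mulr1; lra.
  by apply: le_trans tf _; rewrite lerDr mulr_ge0.
have interE : level f t `&` (X `&` level f (t - a)) = X `&` level f t.
  by apply/seteqP; split=> x [? []] *; split => //; split=> //; exact: sub.
have := phi_submodular (measurable_level t mf)
  (measurableI _ _ mX (measurable_level (t - a) mf)).
rewrite interE -levelE -/g /h0 -/(h t) -/(h (t - a)) /b !indicE.
have -> : (t \in `]-oo, 0%R]%classic) = (t <= 0) by rewrite mem_setE in_itv.
have -> : (t + - a \in `]-oo, 0%R]%classic) = (t <= a).
  by rewrite mem_setE in_itv/= subr_le0.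
have -> : (t \in `]0%R, a]%classic) = (0 < t <= a) by rewrite mem_setE in_itv.
have [t0|t0] := leP t 0; have [ta|ta] := leP t a; rewrite /= ?mulr0 ?mulr1; lra.
Qed.

(** The nonnegative combinations f of indicators of measurable sets, each paired
    with the same combination r of the values of phi; f may have several
    representations and thus several r. *)
Inductive indic_cone : (J -> R) -> R -> Prop :=
| indic_cone0 : indic_cone (cst 0) 0
| indic_cone_add a X f r : 0 <= a -> measurable X -> indic_cone f r ->
    indic_cone (fun x => a * \1_X x + f x) (a * phi X + r).

Lemma indic_cone_bmeas f r : indic_cone f r -> bmeas f /\ forall x, 0 <= f x.
Proof.
elim=> [|a X g s a0 mX _ [bg g0]]; first by split=> //; exact: bmeas_cst.
split; first by apply: bmeas_lin => //; exact: bmeas_indic.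
by move=> x; rewrite addr_ge0// mulr_ge0// indicE ler0n.
Qed.

(** The half of Lovasz's theorem on Choquet integrals that duality needs: among
    all combinations of indicators representing f, the level sets of f are the
    cheapest. *)
Lemma choquet_indic_cone f r : indic_cone f r -> choquet phi f <= r.
Proof.
elim=> [|a X g s a0 mX cg IH]; first by rewrite choquet0.
have [bg g0] := indic_cone_bmeas cg.
by apply: le_trans (choquet_add_indic bg g0 mX a0) _; rewrite lerD2l.
Qed.

Lemma indic_coneD f r g s : indic_cone f r -> indic_cone g s ->
  indic_cone (f \+ g) (r + s).
Proof.
move=> + cg; elim=> [|a X h t a0 mX _ IH].
  by rewrite add0r (_ : _ \+ g = g)//; apply/funext => x /=; rewrite add0r.
rewrite -addrA (_ : _ \+ g = fun x => a * \1_X x + (h \+ g) x).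
  exact: indic_cone_add.
by apply/funext => x /=; rewrite addrA.
Qed.

Lemma indic_coneZ (c : R) f r : 0 <= c -> indic_cone f r ->
  indic_cone (fun x => c * f x) (c * r).
Proof.
move=> c0; elim=> [|a X h t a0 mX _ IH].
  by under eq_fun do rewrite /= mulr0; rewrite mulr0; exact: indic_cone0.
rewrite mulrDr mulrA.
under eq_fun do rewrite mulrDr mulrA.
by apply: indic_cone_add => //; exact: mulr_ge0.
Qed.

End choquet_integral.

(** * The layer cake formula for flows *)

Section layer_cake.
Context (R : realType) (d : measure_display) (T : measurableType d).
Notation mu := (@lebesgue_measure R).
Implicit Types (u : T -> R).

(** The superlevel set of u at t, made empty for negative t so that the layer
    cake integral can be taken over the whole line. *)
Definition nonneg_level u (t : R) : set T := [set x | 0 <= t <= u x].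

(** Tonelli for the region between 0 and the graph of u. *)
Lemma finite_measure_layer_cake (P : {finite_measure set T -> \bar R}) u :
  bmeas u -> (forall x, 0 <= u x) ->
  mu.-integrable setT (EFin \o (fun t => fine (P (nonneg_level u t)))) /\
  \int[P]_x u x = \int[mu]_t fine (P (nonneg_level u t)).
Proof.
move=> bu u0; have [K uK] := bmeasP bu.
pose A : set (T * measurableTypeR R) := [set z | 0 <= z.2 <= u z.1].
have mA : measurable A.
  have m2 : measurable_fun setT (fun z : T * measurableTypeR R => z.2 : R).
    exact: measurable_snd.
  have m1 : measurable_fun setT (fun z : T * measurableTypeR R => u z.1).
    exact: measurableT_comp bu.2 measurable_fst.
  have -> : A = (setT `&` [set z | 0 <= z.2]) `&` (setT `&` [set z | z.2 <= u z.1]).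
    by apply/seteqP; split=> z; rewrite /A/=; [move=> /andP[]|move=> [[_ ->] [_ ->]]].
  by apply: measurableI; apply: measurable_fun_le.
have Ay t : ysection A t = nonneg_level u t.
  by apply/seteqP; split=> x; rewrite /ysection/= inE.
have mL t : measurable (nonneg_level u t) by rewrite -Ay; exact: measurable_ysection.
have := indic_fubini_tonelli P mu mA.
rewrite (indic_fubini_tonelli_FE mu mA) (indic_fubini_tonelli_GE P mA) => fub.
have mP : measurable_fun setT (fun t : R => P (nonneg_level u t)).
  have := measurable_fun_ysection P mA.
  by congr measurable_fun; apply/funext => t /=; rewrite Ay.
split.
  apply: (@bounded_support_integrable _ _ 0 `|K|).
    split; last exact: measurableT_comp.
    apply/bounded_fun_le; exists (fine (P setT)) => t.
    by rewrite ger0_norm ?fine_ge0// fine_le ?fin_num_measure// le_measure ?inE.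
  move=> t; apply: contraNT => tK; rewrite (_ : nonneg_level u t = set0) ?measure0//.
  rewrite -subset0 => x /= /andP[t0 tu]; move/negP: tK; apply.
  rewrite t0/=; apply: le_trans tu _; apply: le_trans (ler_norm _) _.
  exact: le_trans (uK x) (ler_norm K).
rewrite /Rintegral.
have -> : (\int[P]_x (u x)%:E)%E = (\int[P]_x (mu \o xsection A) x)%E.
  apply: eq_integral => x _ /=.
  have -> : xsection A x = [set` `[0, u x] ].
    by apply/seteqP; split=> t; rewrite /xsection/= inE in_itv.
  rewrite lebesgue_measure_itv/= lte_fin; case: ifPn; first by rewrite sube0.
  by rewrite -leNgt => ux; congr EFin; apply/eqP; rewrite eq_le ux u0.
rewrite fub; congr fine; apply: eq_integral => t _ /=.
by rewrite Ay fineK// fin_num_measure.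
Qed.

Lemma charge_layer_cake (nu : {charge set T -> \bar R}) u :
  bmeas u -> (forall x, 0 <= u x) ->
  mu.-integrable setT (EFin \o (fun t => fine (nu (nonneg_level u t)))) /\
  charge_integral nu u = \int[mu]_t fine (nu (nonneg_level u t)).
Proof.
move=> bu u0; have [P [N [nuE ciE]]] := charge_integral_difference nu.
have [iP eP] := finite_measure_layer_cake P bu u0.
have [iN eN] := finite_measure_layer_cake N bu u0.
have -> : (fun t => fine (nu (nonneg_level u t))) =
    (fun t => fine (P (nonneg_level u t)) - fine (N (nonneg_level u t))).
  apply/funext => t.
  have mL : measurable (nonneg_level u t).
    have [t0|t0] := leP 0 t.
      have -> : nonneg_level u t = level u t.
        by apply/seteqP; split=> x; rewrite /nonneg_level/level/= t0.
      by apply: measurable_level; case: bu.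
    rewrite (_ : nonneg_level u t = set0)// -subset0 => x.
    by rewrite /nonneg_level/= leNgt t0.
  by rewrite nuE// fineB ?fin_num_measure.
split; first exact: (integrableB measurableT iP iN).
by rewrite ciE eP eN RintegralB.
Qed.

End layer_cake.

Section flows.
Context (R : realType) (d : measure_display) (J : measurableType d).
Implicit Types (f : J -> R) (X : set J) (nu : {charge set (J * J)%type -> \bar R}).

Lemma bmeas_fst f : bmeas f -> bmeas (fun z : J * J => f z.1).
Proof.
move=> [/bounded_fun_le[M fM] mf]; split; first by apply/bounded_fun_le; exists M.
exact: measurableT_comp mf measurable_fst.
Qed.

Lemma bmeas_snd f : bmeas f -> bmeas (fun z : J * J => f z.2).
Proof.
move=> [/bounded_fun_le[M fM] mf]; split; first by apply/bounded_fun_le; exists M.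
exact: measurableT_comp mf measurable_snd.
Qed.

Lemma potentialE f : potential f = (fun z => f z.1) \- (fun z => f z.2).
Proof. by []. Qed.

Lemma bmeas_potential f : bmeas f -> bmeas (potential f).
Proof.
by move=> bf; apply: bmeasD (bmeas_fst bf) (bmeasN (bmeas_snd bf)).
Qed.

(** The boundary of a flow is its integral against the potential of an
    indicator, which is 1_(X x X^c) - 1_(X^c x X). *)
Lemma boundaryE nu X : measurable X ->
  boundary nu X = (charge_integral nu (potential (\1_X)))%:E.
Proof.
move=> mX; have mXc := measurableC mX.
have m1 := measurableX mX mXc; have m2 := measurableX mXc mX.
have -> : potential (\1_X) = (\1_(X `*` ~` X) : _ -> R) \- \1_(~` X `*` X).
  apply/funext => -[x y]; rewrite /potential /= !indicE !in_setX !in_setC/=.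
  by case: (x \in X); case: (y \in X); rewrite ?subr0 ?sub0r ?subrr.
rewrite (blinB (charge_integral_bounded_linear nu));
  [|exact: bmeas_indic|exact: bmeas_indic].
by rewrite !charge_integral_indic// EFinB !fineK// fin_num_measure.
Qed.

Variable phi : set J -> R.
Hypotheses (phi_bounded : [bounded phi A | A in measurable])
  (phi_continuous : setfun_continuous phi)
  (phi0 : phi set0 = 0) (phiT : phi setT = 0).

(** By the layer cake formula nu (potential f) is the integral over t of the
    boundary of nu at {f >= t}; it is here that the inequality between the
    boundary and phi passes from sets to functions. *)
Lemma flow_potential_le nu f :
  (forall X, measurable X -> (boundary nu X <= (phi X)%:E)%E) -> bmeas f ->
  charge_integral nu (potential f) <= choquet phi f.
Proof.
move=> nuphi.
wlog f0 : f / forall x, 0 <= f x.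
  move=> wlog0 bf; have [K fK] := bmeasP bf.
  have -> : potential f = potential (fun x => f x + K).
    by apply/funext => z; rewrite /potential; ring.
  rewrite -(choquet_addr phi_bounded phi_continuous phi0 phiT K bf).
  apply: wlog0; last exact: bmeasD bf (bmeas_cst _ K).
  by move=> x; have := fK x; rewrite ler_norml => /andP[]; lra.
move=> bf; have b1 := bmeas_fst bf; have b2 := bmeas_snd bf.
have lin := charge_integral_bounded_linear nu.
rewrite potentialE (blinB lin b1 b2) choquetE//.
have [i1 ->] := charge_layer_cake nu b1 (fun z => f0 z.1).
have [i2 ->] := charge_layer_cake nu b2 (fun z => f0 z.2).
rewrite -RintegralB//; apply: le_Rintegral => //.
- exact: (integrableB measurableT i1 i2).
- exact: integrable_profile.
move=> t _; have [t0|t0] := leP 0 t; last first.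
  have E (u : J * J -> R) : nonneg_level u t = set0.
    by rewrite -subset0 => z; rewrite /nonneg_level/= leNgt t0.
  rewrite !E subrr (_ : level f t = setT) ?phiT// -subTset => x _.
  by rewrite /level/=; apply: le_trans (ltW t0) (f0 x).
have mX : measurable (level f t) by apply: measurable_level; case: bf.
have -> : nonneg_level (fun z : J * J => f z.1) t = level f t `*` setT.
  by apply/seteqP; split=> z; rewrite /nonneg_level/level/= t0; [|case].
have -> : nonneg_level (fun z : J * J => f z.2) t = setT `*` level f t.
  by apply/seteqP; split=> z; rewrite /nonneg_level/level/= t0; [|case].
have m1 := measurableX mX (@measurableT _ J).
have m2 := measurableX (@measurableT _ J) mX.
rewrite -!charge_integral_indic// -(blinB lin (bmeas_indic _ m1) (bmeas_indic _ m2)).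
rewrite -lee_fin; apply: le_trans (nuphi _ mX); rewrite boundaryE// lee_fin.
rewrite le_eqVlt; apply/orP; left; apply/eqP; congr charge_integral.
apply/funext => -[x y]; rewrite /potential /= !indicE !in_setX/=.
by rewrite !in_setT andbT.
Qed.

End flows.

(** * Linear constraints in an order interval of charges *)

Section bmeas_space.
Context (R : realType) (d : measure_display) (T : measurableType d).

Definition bmeas_pred : {pred T -> R} := fun g => `[< bmeas g >].

Lemma bmeas_predP g : reflect (bmeas g) (g \in bmeas_pred).
Proof. exact: asboolP. Qed.

(** The Hahn-Banach argument needs a vector space: the bounded measurable
    functions as a submodule of all functions. *)
Record bmeas_space :=
  BMeas { bmeas_val :> T -> R; bmeas_valP : bmeas_val \in bmeas_pred }.

HB.instance Definition _ := [isSub for bmeas_val].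
HB.instance Definition _ := [Choice of bmeas_space by <:].

Let bmeas_submod_closed : submod_closed bmeas_pred.
Proof.
split; first by apply/bmeas_predP; exact: bmeas_cst.
move=> a g h /bmeas_predP bg /bmeas_predP bh; apply/bmeas_predP.
exact: bmeas_lin.
Qed.

HB.instance Definition _ :=
  GRing.isSubmodClosed.Build _ _ bmeas_pred bmeas_submod_closed.
HB.instance Definition _ := [SubChoice_isSubLmodule of bmeas_space by <:].

Definition to_bmeas (g : T -> R) : bmeas_space := insubd 0 g.

Lemma to_bmeasK g : bmeas g -> to_bmeas g = g :> (T -> R).
Proof. by move=> /bmeas_predP gb; exact: insubdK. Qed.

Lemma bmeas_val_bmeas (g : bmeas_space) : bmeas g.
Proof. exact/bmeas_predP/bmeas_valP. Qed.

End bmeas_space.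

Section charge_interval.
Context (R : realType) (d : measure_display) (T : measurableType d).
Variables alpha beta : {charge set T -> \bar R}.
Hypothesis alpha_beta : charge_le alpha beta.
Implicit Types (g h : T -> R) (nu : {charge set T -> \bar R}).

(** The largest and the smallest value that nu g can take when
    alpha <= nu <= beta: put beta where g is positive and alpha where it is
    negative, or the other way round. *)
Definition box_sup g := charge_integral beta g^\+ - charge_integral alpha g^\-.
Definition box_inf g := charge_integral alpha g^\+ - charge_integral beta g^\-.

Lemma box_infE g : box_inf g = - box_sup (\- g).
Proof. by rewrite /box_inf /box_sup funrposN funrnegN [RHS]opprB. Qed.

Lemma charge_integral_pos_neg nu g : bmeas g ->
  charge_integral nu g = charge_integral nu g^\+ - charge_integral nu g^\-.
Proof.
move=> bg.
rewrite -(blinB (charge_integral_bounded_linear nu) (bmeas_pos bg) (bmeas_neg bg)).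
by congr charge_integral; exact/esym/funrposBneg.
Qed.

(** The form in which sublinearity is visible, beta - alpha being positive. *)
Lemma box_supE g : bmeas g -> box_sup g = charge_integral alpha g +
  (charge_integral beta g^\+ - charge_integral alpha g^\+).
Proof. by move=> bg; rewrite /box_sup (charge_integral_pos_neg alpha bg); ring. Qed.

Lemma box_supD g h : bmeas g -> bmeas h ->
  box_sup (g \+ h) <= box_sup g + box_sup h.
Proof.
move=> bg bh; have bgh := bmeasD bg bh.
rewrite !box_supE// (blinD (charge_integral_bounded_linear alpha) bg bh).
have bp := bmeasD (bmeas_pos bg) (bmeas_pos bh).
have bD := bmeasD bp (bmeasN (bmeas_pos bgh)).
have D0 x : 0 <= (g^\+ \+ h^\+ \+ (\- (g \+ h)^\+)) x.
  rewrite /= subr_ge0 /funrpos ge_max; apply/andP; split.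
    by apply: lerD; rewrite le_max lexx.
  by apply: addr_ge0; rewrite le_max lexx orbT.
have := le_charge_integral alpha_beta bD D0.
rewrite !(blinD (charge_integral_bounded_linear _) bp (bmeasN (bmeas_pos bgh))).
rewrite !(blinN (charge_integral_bounded_linear _) (bmeas_pos bgh)).
rewrite !(blinD (charge_integral_bounded_linear _) (bmeas_pos bg) (bmeas_pos bh)).
lra.
Qed.

Lemma box_supZ (t : R) g : bmeas g -> 0 <= t ->
  box_sup (fun x => t * g x) = t * box_sup g.
Proof.
move=> bg t0; have bZ := bmeasZ t bg; rewrite !box_supE//.
have -> : (fun x => t * g x)^\+ = fun x => t * g^\+ x.
  by apply/funext => x; rewrite /funrpos maxr_pMr// mulr0.
rewrite (blinZ (charge_integral_bounded_linear alpha) _ bg).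
rewrite !(blinZ (charge_integral_bounded_linear _) _ (bmeas_pos bg)).
ring.
Qed.

Lemma box_infZ (t : R) g : bmeas g -> 0 <= t ->
  box_inf (fun x => t * g x) = t * box_inf g.
Proof.
move=> bg t0; rewrite !box_infE mulrN -box_supZ//; last exact: bmeasN.
by congr (- box_sup _); apply/funext => x /=; rewrite mulrN.
Qed.

Lemma box_infD g h : bmeas g -> bmeas h ->
  box_inf g + box_inf h <= box_inf (g \+ h).
Proof.
move=> bg bh; rewrite !box_infE -opprD lerN2.
have := box_supD (bmeasN bg) (bmeasN bh).
by under [X in box_sup X <= _ -> _]eq_fun do rewrite -opprD.
Qed.

Lemma box_sup_ge nu g : charge_le alpha nu -> charge_le nu beta -> bmeas g ->
  charge_integral nu g <= box_sup g.
Proof.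
move=> anu nub bg; rewrite (charge_integral_pos_neg nu bg).
apply: lerB; apply: le_charge_integral => //.
- exact: bmeas_pos.
- exact: bmeas_neg.
Qed.

Lemma box_inf_le nu g : charge_le alpha nu -> charge_le nu beta -> bmeas g ->
  box_inf g <= charge_integral nu g.
Proof.
move=> anu nub bg; rewrite box_infE lerNl.
rewrite -(blinN (charge_integral_bounded_linear nu) bg).
by apply: box_sup_ge => //; exact: bmeasN.
Qed.

Lemma box_sup_bound : exists K : R, forall g (e : R), bmeas g ->
  (forall x, `|g x| <= e) -> box_sup g <= K * e.
Proof.
have [_ [Ka ba]] := charge_integral_bounded_linear alpha.
have [_ [Kb bb]] := charge_integral_bounded_linear beta.
exists (Kb + Ka) => g e bg ge.
have gpn x : `|g^\+ x| <= e /\ `|g^\- x| <= e.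
  rewrite !ger0_norm ?funrpos_ge0 ?funrneg_ge0// /funrpos /funrneg !ge_max.
  by have := ge x; have := normr_ge0 (g x); rewrite ler_norml; split; lra.
have := bb _ _ (bmeas_pos bg) (fun x => (gpn x).1).
have := ba _ _ (bmeas_neg bg) (fun x => (gpn x).2).
by rewrite /box_sup mulrDl !ler_norml => /andP[? ?] /andP[? ?]; lra.
Qed.

(** Linear constraints, forming a cone, are solvable within the order interval
    from alpha to beta as soon as each one is solvable alone: box_sup is
    sublinear, and a linear functional below it lies between alpha and beta on
    indicators. *)
Lemma charge_between_cone (K : set (bmeas_space R T * R)) : convex_cone K ->
  (forall z, K z -> box_inf z.1 <= z.2) ->
  exists nu : {charge set T -> \bar R},
    [/\ charge_le alpha nu, charge_le nu beta &
        forall z, K z -> charge_integral nu z.1 <= z.2].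
Proof.
move=> cK Kinf.
pose q (g : bmeas_space R T) := box_sup g.
have sq : sublinear q.
  split=> [g h|t g t0].
    exact: box_supD (bmeas_val_bmeas g) (bmeas_val_bmeas h).
  exact: box_supZ (bmeas_val_bmeas g) t0.
have qK z : K z -> 0 <= q (- z.1) + z.2.
  by move=> Kz; have := Kinf z Kz; rewrite box_infE -subr_ge0 opprK addrC.
have [L [Llin Lq LK]] := mazur_orlicz sq cK qK.
pose F g := L (to_bmeas g).
have LN (g : bmeas_space R T) : L (- g) = - L g.
  have := Llin (-1) g 0; have := Llin 1 0 0.
  by rewrite scaler0 scaleN1r !addr0; lra.
have FE (g : bmeas_space R T) : F g = L g.
  by rewrite /F; congr L; apply: val_inj; rewrite /= to_bmeasK//; exact: bmeas_val_bmeas.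
(* below box_sup at - g means above box_inf at g *)
have FN g : bmeas g -> - F g <= box_sup (\- g).
  move=> bg; rewrite /F -LN; apply: le_trans (Lq _) _; rewrite /q /=.
  by rewrite -[X in box_sup X](_ : - (to_bmeas g : T -> R) = _) ?to_bmeasK.
have Fle g : bmeas g -> F g <= box_sup g.
  by move=> bg; apply: le_trans (Lq _) _; rewrite /q to_bmeasK.
have linF : bounded_linear F.
  split=> [a g h bg bh|].
    rewrite /F -Llin; congr L; apply: val_inj; rewrite /= !to_bmeasK//.
    exact: bmeas_lin.
  have [C bC] := box_sup_bound; exists C => g e bg ge.
  rewrite ler_norml lerNl; apply/andP; split.
    apply: le_trans (FN _ bg) _; apply: bC; first exact: bmeasN.
    by move=> x /=; rewrite normrN.
  exact: le_trans (Fle _ bg) (bC _ _ bg ge).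
have indic_pos A : (\1_A : T -> R)^\+ = \1_A.
  by apply/funext => x; rewrite /funrpos max_l// indicE ler0n.
have indic_neg A : (\1_A : T -> R)^\- = cst 0.
  by apply/funext => x; rewrite /funrneg max_r// oppr_le0 indicE ler0n.
have ci0 (la : {charge set T -> \bar R}) : charge_integral la (cst 0) = 0.
  exact: blin0 (charge_integral_bounded_linear la).
have [A mA|A mA|nu [anu nub nuF]] := @charge_of_functional _ _ _ F alpha beta linF.
- have := FN _ (bmeas_indic R mA).
  rewrite lerNl -box_infE /box_inf indic_pos indic_neg ci0 subr0.
  by rewrite charge_integral_indic.
- apply: le_trans (Fle _ (bmeas_indic R mA)) _.
  by rewrite /box_sup indic_pos indic_neg ci0 subr0 charge_integral_indic.
exists nu; split=> // z Kz.
by rewrite nuF ?FE; [exact: LK|exact: bmeas_val_bmeas].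
Qed.

End charge_interval.

(** * Duality for flows *)

Section feasible_flows.
Context (R : realType) (d : measure_display) (J : measurableType d).
Variables (alpha beta : {charge set (J * J)%type -> \bar R}) (phi : set J -> R).
Hypotheses (alpha_beta : charge_le alpha beta)
  (phi_bounded : [bounded phi A | A in measurable])
  (phi_continuous : setfun_continuous phi) (phi_submodular : submodular phi)
  (phi0 : phi set0 = 0) (phiT : phi setT = 0).
Implicit Types (f : J -> R) (v : (J * J)%type -> R) (r b c : R).

(** The constraints boundary nu X <= phi X for measurable X, nu v <= c and
    nu (- v) <= - c generate the cone of the constraints
    nu (potential f + b v) <= r + b c, for (f, r) in the cone of phi and b of
    either sign. *)
Lemma exists_flow v c : bmeas v ->
  (forall f r b, indic_cone phi f r ->
     box_inf alpha beta (fun z => potential f z + b * v z) <= r + b * c) ->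
  exists2 nu, feasible alpha beta phi nu & charge_integral nu v = c.
Proof.
move=> bv dual.
pose K := [set z : bmeas_space R (J * J)%type * R | exists f r b,
  [/\ indic_cone phi f r, z.1 = (fun z => potential f z + b * v z) :> (_ -> R) &
      z.2 = r + b * c]].
have cK : convex_cone K.
  split.
  - exists (cst 0), 0, 0; split; first exact: indic_cone0.
      by apply/funext => z; rewrite /potential /= subrr mul0r addr0.
    by rewrite mul0r addr0.
  - move=> z w [f [r [b [cf zE1 zE2]]]] [g [s [e [cg wE1 wE2]]]].
    exists (f \+ g), (r + s), (b + e); split; first exact: indic_coneD.
      apply/funext => y; rewrite [LHS](_ : _ = (z.1 : _ -> R) y + (w.1 : _ -> R) y)//.
      by rewrite zE1 wE1 /potential /=; ring.
    by rewrite /= zE2 wE2; ring.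
  - move=> t z t0 [f [r [b [cf zE1 zE2]]]].
    exists (fun x => t * f x), (t * r), (t * b); split; first exact: indic_coneZ.
      apply/funext => y; rewrite [LHS](_ : _ = t * (z.1 : _ -> R) y)// zE1.
      by rewrite /potential; ring.
    by rewrite /= zE2; ring.
have Kinf z : K z -> box_inf alpha beta z.1 <= z.2.
  by move=> [f [r [b [cf -> ->]]]]; exact: dual.
have [nu [anu nub nuK]] := charge_between_cone alpha_beta cK Kinf.
have nuKE f r b : indic_cone phi f r ->
    charge_integral nu (fun z => potential f z + b * v z) <= r + b * c.
  move=> cf; have [bf _] := indic_cone_bmeas cf.
  have bg : bmeas (fun z => potential f z + b * v z).
    exact: bmeasD (bmeas_potential bf) (bmeasZ b bv).
  rewrite -(to_bmeasK bg).
  by apply: (nuK (to_bmeas _, _)); exists f, r, b; rewrite to_bmeasK.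
exists nu; first split=> // X mX.
  rewrite boundaryE// lee_fin.
  have cX := indic_cone_add ler01 mX (indic_cone0 phi).
  have := nuKE _ _ 0 cX; rewrite mul0r mul1r !addr0; congr (charge_integral nu _ <= _).
  by apply/funext => z; rewrite /potential /=; ring.
have p0 : potential (cst 0) = cst 0 :> (J * J -> R).
  by apply/funext => z; rewrite /potential /= subrr.
have c0 := indic_cone0 phi.
apply: le_anti; apply/andP; split.
  have := nuKE _ _ 1 c0; rewrite add0r mul1r; congr (charge_integral nu _ <= _).
  by apply/funext => z; rewrite p0 /= add0r mul1r.
have := nuKE _ _ (-1) c0.
rewrite add0r mulN1r lerNr -(blinN (charge_integral_bounded_linear nu)).
  congr (_ <= charge_integral nu _).
  by apply/funext => z; rewrite p0 /=; ring.
exact: bmeasD (bmeas_potential (bmeas_cst _ _)) (bmeasZ _ bv).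
Qed.

Variable v : (J * J)%type -> R.
Hypothesis bv : bmeas v.

Definition lower_dual f := box_inf alpha beta (potential f \+ v) - choquet phi f.
Definition upper_dual f := box_sup alpha beta (potential f \+ v) + choquet phi (\- f).

(** nu v = nu (potential f + v) - nu (potential f). The first term lies in the
    range allowed by alpha and beta, and the second in the range given by the
    Choquet integrals at f and - f. *)
Lemma weak_duality nu f : feasible alpha beta phi nu -> bmeas f ->
  lower_dual f <= charge_integral nu v <= upper_dual f.
Proof.
move=> [anu nub nuphi] bf; have bp := bmeas_potential bf.
have lin := charge_integral_bounded_linear nu.
have bpv := bmeasD bp bv.
have nuf := flow_potential_le phi_bounded phi_continuous phi0 phiT nuphi bf.
have := flow_potential_le phi_bounded phi_continuous phi0 phiT nuphi (bmeasN bf).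
have -> : potential (\- f) = \- potential f.
  by apply/funext => z; rewrite /potential /=; ring.
rewrite (blinN lin bp) => nufN.
have := box_inf_le anu nub bpv; have := box_sup_ge anu nub bpv.
rewrite (blinD lin bp bv) /lower_dual /upper_dual; lra.
Qed.

Lemma box_inf_cone_le nu f r : feasible alpha beta phi nu ->
  indic_cone phi f r -> box_inf alpha beta (potential f) <= r.
Proof.
move=> [anu nub nuphi] cf; have [bf _] := indic_cone_bmeas cf.
apply: le_trans (choquet_indic_cone _ _ _ _ _ cf) => //.
apply: le_trans (flow_potential_le _ _ _ _ nuphi bf) => //.
by apply: box_inf_le => //; exact: bmeas_potential.
Qed.

(** A lower bound with f and an upper bound with M - f involve opposite potentials
    and the same Choquet integral: this trades - f for a nonnegative
    function. *)
Lemma reflect_bmeas f : bmeas f -> exists M : R,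
  let f' := fun x => M - f x in
  [/\ bmeas f', forall x, 0 <= f' x, potential f' = \- potential f &
      choquet phi (\- f') = choquet phi f].
Proof.
move=> bf; have [M fM] := bmeasP bf; exists M => f'; split.
- exact: bmeasD (bmeas_cst _ M) (bmeasN bf).
- by move=> x; have := fM x; rewrite /f' ler_norml => /andP[]; lra.
- by apply/funext => z; rewrite /potential /f' /=; ring.
- rewrite -(choquet_addr phi_bounded phi_continuous phi0 phiT (- M) bf).
  by congr choquet; apply/funext => x /=; rewrite /f'; ring.
Qed.

(** The combined constraints with b > 0 scale to b = 1, where they follow from the
    lower bound on c at f; those with b < 0 scale to b = -1 and follow from the
    upper bound at M - f; those with b = 0 hold because some feasible flow
    exists. *)
Lemma strong_duality c : feasible alpha beta phi !=set0 ->
  (forall f, bmeas f -> (forall x, 0 <= f x) -> lower_dual f <= c <= upper_dual f) ->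
  exists2 nu, feasible alpha beta phi nu & charge_integral nu v = c.
Proof.
move=> [nu0 fnu0] dual; apply: exists_flow => // f r b cf.
have [bf f0] := indic_cone_bmeas cf.
have [b0|b0|->] := ltrgt0P b.
- have cg : indic_cone phi (fun x => b^-1 * f x) (b^-1 * r).
    by apply: indic_coneZ => //; rewrite invr_ge0 ltW.
  have [bg g0] := indic_cone_bmeas cg; set g := fun x => _ in cg bg g0.
  have /andP[+ _] := dual _ bg g0; rewrite /lower_dual.
  have := choquet_indic_cone phi_bounded phi_continuous phi0 phiT phi_submodular cg.
  have -> : (fun z => potential f z + b * v z) =
      fun z => b * (potential g \+ v) z.
    apply/funext => z; rewrite /potential /g /= mulrDr mulrBr !mulrA divff ?gt_eqF//.
    by rewrite !mul1r.
  rewrite (box_infZ _ _ (bmeasD (bmeas_potential bg) bv) (ltW b0)) => chr le.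
  rewrite -ler_pdivlMl// mulrDr mulrA mulVf ?gt_eqF// mul1r; lra.
- have b0' : 0 < - b by rewrite oppr_gt0.
  have cg : indic_cone phi (fun x => (- b)^-1 * f x) ((- b)^-1 * r).
    by apply: indic_coneZ => //; rewrite invr_ge0 ltW.
  have [bg _] := indic_cone_bmeas cg; set g := fun x => _ in cg bg.
  have [M [bg' g'0 pg' chg']] := reflect_bmeas bg.
  have /andP[_ +] := dual _ bg' g'0; rewrite /upper_dual chg' pg'.
  have := choquet_indic_cone phi_bounded phi_continuous phi0 phiT phi_submodular cg.
  have bgv : bmeas (potential g \- v) := bmeasD (bmeas_potential bg) (bmeasN bv).
  have -> : (fun z => potential f z + b * v z) =
      fun z => (- b) * (potential g \- v) z.
    apply/funext => z; rewrite /potential /g /= !mulrBr !mulrA divff ?gt_eqF//.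
    by rewrite !mul1r mulNr opprK.
  rewrite (box_infZ _ _ bgv (ltW b0')) box_infE.
  have -> : \- (potential g \- v) = \- potential g \+ v.
    by apply/funext => z /=; ring.
  move=> chr le; rewrite -ler_pdivlMl// mulrDr mulrA.
  have -> : (- b)^-1 * b = -1 by rewrite invrN mulNr mulVf ?lt_eqF.
  by rewrite mulN1r; lra.
- rewrite mul0r addr0; under eq_fun do rewrite mul0r addr0.
  exact: box_inf_cone_le fnu0 cf.
Qed.

(** Without feasible flows, already the constraints that do not mention v are
    contradictory, so that box_inf (potential f) > r for some (f, r). Along the
    ray t f the lower bound then grows at least like t (box_inf - r), and the
    upper bound at the reflected functions decreases likewise. *)
Lemma infeasible_unbounded : feasible alpha beta phi = set0 -> forall M : R,
  (exists f, [/\ bmeas f, forall x, 0 <= f x & M <= lower_dual f]) /\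
  (exists f, [/\ bmeas f, forall x, 0 <= f x & upper_dual f <= M]).
Proof.
move=> noflow.
have [f [r [cf]]] : exists f r, indic_cone phi f r /\ r < box_inf alpha beta (potential f).
  apply: contrapT => nex.
  have [|nu fnu _] := @exists_flow (cst 0) 0 (bmeas_cst _ 0); last first.
    by rewrite noflow in fnu.
  move=> f r b cf; have -> : r + b * 0 = r by rewrite mulr0 addr0.
  rewrite (_ : (fun z => _) = potential f); last first.
    by apply/funext => z; rewrite /= mulr0 addr0.
  by rewrite leNgt; apply/negP => rf; apply: nex; exists f, r.
rewrite -subr_gt0 => e0; set e := _ - r in e0.
have [bf f0] := indic_cone_bmeas cf.
have key (t : R) : 0 <= t -> let g := fun x => t * f x in
    [/\ bmeas g, forall x, 0 <= g x, choquet phi g <= t * r &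
       box_inf alpha beta (potential g) = t * box_inf alpha beta (potential f)].
  move=> t0 g; have cg := indic_coneZ t0 cf; have [bg g0] := indic_cone_bmeas cg.
  split=> //; first exact: choquet_indic_cone.
  rewrite -box_infZ//; last exact: bmeas_potential.
  by congr box_inf; apply/funext => z; rewrite /potential /g; ring.
move=> M; split.
- have [] := key (`|M - box_inf alpha beta v| / e) _; first by rewrite divr_ge0// ltW.
  set t := _ / e; set g := fun x => _ => bg g0 chg ig; exists g; split=> //.
  have := box_infD alpha_beta (bmeas_potential bg) bv.
  have : t * e = `|M - box_inf alpha beta v| by rewrite /t divfK ?gt_eqF.
  have := ler_norm (M - box_inf alpha beta v).
  by rewrite ig /lower_dual /e; lra.
- have [] := key (`|box_sup alpha beta v - M| / e) _; first by rewrite divr_ge0// ltW.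
  set t := _ / e; set g := fun x => _ => bg g0 chg ig.
  have [m [bg' g'0 pg' chg']] := reflect_bmeas bg; exists (fun x => m - g x); split=> //.
  have := box_supD alpha_beta (bmeasN (bmeas_potential bg)) bv.
  have : t * e = `|box_sup alpha beta v - M| by rewrite /t divfK ?gt_eqF.
  have := ler_norm (box_sup alpha beta v - M).
  by move: ig; rewrite box_infE /upper_dual chg' pg' /e; lra.
Qed.

End feasible_flows.

(** * Attained and extremal flow values *)

Theorem theorem3p10 (R : realType) (d : measure_display) (J : measurableType d)
    (alpha beta : {charge set (J * J)%type -> \bar R}) (phi : set J -> R)
    (v : (J * J)%type -> R) :
  standard_borel R J ->
  charge_le alpha beta ->
  [bounded phi A | A in measurable] ->
  setfun_continuous phi ->
  submodular phi ->
  phi set0 = 0 ->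
  phi setT = 0 ->
  (forall xy, 0 <= v xy) ->
  bounded_fun v ->
  measurable_fun setT v ->
  [/\ forall c : R,
        (exists2 mu, feasible alpha beta phi mu & charge_integral mu v = c) <->
        (feasible alpha beta phi !=set0 /\
         forall f : J -> R, bounded_fun f -> measurable_fun setT f ->
           (forall x, 0 <= f x) ->
           charge_integral alpha (potential f \+ v)^\+
             - charge_integral beta (potential f \+ v)^\-
             - choquet phi f <= c
           /\ c <= charge_integral beta (potential f \+ v)^\+
                   - charge_integral alpha (potential f \+ v)^\-
                   + choquet phi (\- f)),
      ereal_inf [set (charge_integral mu v)%:E | mu in feasible alpha beta phi]
      = ereal_sup
          [set (charge_integral alpha (potential f \+ v)^\+
                - charge_integral beta (potential f \+ v)^\-
                - choquet phi f)%:E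
          | f in [set f : J -> R | [/\ bounded_fun f, measurable_fun setT f &
                                      forall x, 0 <= f x]]]
    & ereal_sup [set (charge_integral mu v)%:E | mu in feasible alpha beta phi]
      = ereal_inf
          [set (charge_integral beta (potential f \+ v)^\+
                - charge_integral alpha (potential f \+ v)^\-
                + choquet phi (\- f))%:E
          | f in [set f : J -> R | [/\ bounded_fun f, measurable_fun setT f &
                                      forall x, 0 <= f x]]]].
Proof.
move=> _ alpha_beta phib phic phis phi0 phiT _ bdv mv.
have bv : bmeas v by split.
have wd := weak_duality phib phic phi0 phiT bv.
have sd := strong_duality alpha_beta phib phic phis phi0 phiT bv.
have inf_unb := infeasible_unbounded alpha_beta phib phic phis phi0 phiT bv.
have part1 c : (exists2 nu, feasible alpha beta phi nu & charge_integral nu v = c) <->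
    (feasible alpha beta phi !=set0 /\
     forall f : J -> R, bounded_fun f -> measurable_fun setT f -> (forall x, 0 <= f x) ->
       lower_dual alpha beta phi v f <= c /\ c <= upper_dual alpha beta phi v f).
  split=> [[nu fnu <-]|[ne dual]].
    by split; [exists nu|move=> f bf mf _; apply/andP/wd].
  by apply: sd => // f [bf mf] f0; apply/andP/dual.
pose C := [set f : J -> R | [/\ bounded_fun f, measurable_fun setT f &
  forall x, 0 <= f x]].
have C0 : C (cst 0) by have [] := @bmeas_cst R _ J 0; split.
pose lower := ereal_sup [set (lower_dual alpha beta phi v f)%:E | f in C].
pose upper := ereal_inf [set (upper_dual alpha beta phi v f)%:E | f in C].
have lowerP f : C f -> ((lower_dual alpha beta phi v f)%:E <= lower)%E.
  by move=> Cf; apply: ereal_sup_ubound; exists f.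
have upperP f : C f -> (upper <= (upper_dual alpha beta phi v f)%:E)%E.
  by move=> Cf; apply: ereal_inf_lbound; exists f.
have lower_le nu f : feasible alpha beta phi nu -> C f ->
    lower_dual alpha beta phi v f <= charge_integral nu v <= upper_dual alpha beta phi v f.
  by move=> fnu [bf mf _]; exact: wd.
have [empty|/set0P ne] := eqVneq (feasible alpha beta phi) set0.
  have unb := inf_unb empty; split=> //.
    rewrite empty image_set0 ereal_inf0; apply/esym/eq_infty => M.
    have [[f [[bf mf] f0 Mf]] _] := unb M.
    by apply: le_trans (lowerP f _) => //; rewrite lee_fin.
  rewrite empty image_set0 ereal_sup0; apply/esym/eq_ninfty => M.
  have [_ [f [[bf mf] f0 fM]]] := unb M.
  by apply: le_trans (upperP f _) _ => //; rewrite lee_fin.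
have [nu0 fnu0] := ne.
have lower_nu nu : feasible alpha beta phi nu -> (lower <= (charge_integral nu v)%:E)%E.
  move=> fnu; apply: ge_ereal_sup => _ [f Cf <-].
  by rewrite lee_fin; have /andP[] := lower_le nu f fnu Cf.
have upper_nu nu : feasible alpha beta phi nu -> ((charge_integral nu v)%:E <= upper)%E.
  move=> fnu; apply: le_ereal_inf_tmp => _ [f Cf <-].
  by rewrite lee_fin; have /andP[] := lower_le nu f fnu Cf.
have lower_fin : lower \is a fin_num.
  rewrite fin_numElt (lt_le_trans (ltNyr _) (lowerP _ C0))/=.
  exact: le_lt_trans (lower_nu _ fnu0) (ltry _).
have upper_fin : upper \is a fin_num.
  rewrite fin_numElt (le_lt_trans (upperP _ C0) (ltry _)) andbT.
  exact: lt_le_trans (ltNyr _) (upper_nu _ fnu0).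
(* strong duality: the whole interval from lower to upper is attained *)
have attained c : (lower <= c%:E <= upper)%E ->
    exists2 nu, feasible alpha beta phi nu & charge_integral nu v = c.
  move=> /andP[lc cu]; apply: sd => // f [bf mf] f0; rewrite -!lee_fin.
  by rewrite (le_trans (lowerP f _) lc)// (le_trans cu (upperP f _)).
have lower_upper : (lower <= upper)%E := le_trans (lower_nu _ fnu0) (upper_nu _ fnu0).
split=> //; apply: le_anti; apply/andP; split.
- have [|nu fnu nuE] := attained (fine lower); first by rewrite fineK// lexx.
  by rewrite -/lower -(fineK lower_fin) -nuE; apply: ereal_inf_lbound; exists nu.
- by apply: le_ereal_inf_tmp => _ [nu fnu <-]; exact: lower_nu.
- by apply: ge_ereal_sup => _ [nu fnu <-]; exact: upper_nu.
- have [|nu fnu nuE] := attained (fine upper); first by rewrite fineK// lexx andbT.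
  by rewrite -/upper -(fineK upper_fin) -nuE; apply: ereal_sup_ubound; exists nu.
Qed.
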